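(* Let $\mathcal{D}=\{x_1,\dots,x_N\}\subseteq X$, a query $q\in X$ and an integer $K\ge1$ be given, and let $\mathbf{s}(q)\in\mathbb{R}^N$ have entries $s_i(q)=p(x_i,q)^K$. For any $\epsilon>0$ and $\delta\in(0,1)$, the RACE-CMS sketch can be parameterized (choice of the number of rows $d$, columns $w$, and ACE repetitions per cell) so that the total number of ACE estimates used is $$O\!\left(\frac{\|\tilde{\mathbf{s}}(q)\|_1^2\,\|\mathbf{s}(q)\|_1}{\epsilon^3}\log\!\left(\frac{\|\mathbf{s}(q)\|_1}{\epsilon\delta}\log\frac N\delta\right)\log\frac N\delta\right),$$ and, with probability at least $1-\delta$, the recovered vector $\hat{\mathbf{s}}(q)$ satisfies $s_i(q)-\frac\epsilon2\le\hat s_i(q)\le s_i(q)+\frac\epsilon2$ for all $i=1,\dots,N$.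
   Context: An LSH family on $X$ is a distribution over functions $l:X\to\{1,\dots,r\}$ with collision probability $p(x,q)=\Pr_l[l(x)=l(q)]$; $L=(l_1,\dots,l_K)$ with independent $l_j$ has collision probability $p^K$. $\tilde{\mathbf{s}}(q)$ has entries $\sqrt{s_i(q)}$. An ACE estimate with coefficients $c\in[-1,1]^N$: draw $L$ independently, form $A[j]=\sum_i c_i\mathbf{1}\{L(x_i)=j\}$, output $A[L(q)]$ (an unbiased estimate of $\sum_i c_i s_i(q)$). Count-Min Sketch (CMS): choose $d$ independent 2-universal hash functions $h_1,\dots,h_d:\{1,\dots,N\}\to\{1,\dots,w\}$; the CMS of a nonnegative vector $\mathbf{s}$ is the $d\times w$ array $C[a,b]=\sum_{i:h_a(i)=b}s_i$, and the CMS recovery is $s^{\mathrm{CMS}}_i=\min_a C[a,h_a(i)]$. RACE-CMS: each cell $C[a,b]$ of the CMS of $\mathbf{s}(q)$ is estimated by the median-of-means $\hat C[a,b]$ of independent ACE estimates with coefficients $c_i=\mathbf{1}\{h_a(i)=b\}$ (these can be built in one pass over $\mathcal{D}$ without knowing $q$), and $\hat s_i(q)=\min_a\hat C[a,h_a(i)]$.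
   Formalization: The stated bound can be negative (e.g. N=1, δ near 1), so each logarithm in it is read as max(1, log); the bound with plain logarithms is claimed for N ≥ 3 and ε ≤ ‖s(q)‖₁, and zero ACE estimates (output 0) are allowed. *)

(* Defs.v *)
From HB Require Import structures.
From mathcomp Require Import all_boot all_order all_algebra.
From mathcomp Require Import all_classical all_reals all_analysis.

Set Implicit Arguments.
Unset Strict Implicit.
Unset Printing Implicit Defensive.

Import Order.TTheory GRing.Theory Num.Theory.

Local Open Scope classical_set_scope.
Local Open Scope ring_scope.

HB.instance Definition _ (n : nat) := isPointed.Build 'I_n.+1 ord0.

(* Functions X -> {0, ..., r} with the sigma-algebra generated by the
   evaluations at the points of X: a probability on [funspace X r] is a
   distribution over functions from X to a set of r.+1 buckets. *)
Definition evaluation_events (X : Type) (r : nat) : set (set (X -> 'I_r.+1)) :=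
  [set [set f | f a.1 = a.2] | a in [set: X * 'I_r.+1]].

Notation funspace X r := (g_sigma_algebraType (@evaluation_events X r)).

Definition collision_probability (R : realType) (X : Type) (r : nat)
    (mu : probability (funspace X r) R) (x y : X) : R :=
  fine (mu [set f | f x = f y]).

(* The vector s(q), with entries p(x_i, q)^K. *)
Definition similarity (R : realType) (X : Type) (r : nat)
    (mu : probability (funspace X r) R) (K N : nat) (x : 'I_N -> X) (q : X)
    (i : 'I_N) : R :=
  collision_probability mu (x i) q ^+ K.

Definition norm1 (R : realType) (N : nat) (v : 'I_N -> R) : R :=
  \sum_(i < N) `|v i|.

Definition sqrt_vec (R : realType) (N : nat) (v : 'I_N -> R) (i : 'I_N) : R :=
  Num.sqrt (v i).

Definition lsh_tuple (X : Type) (r K : nat) (l : 'I_K -> X -> 'I_r.+1) (y : X) :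
  {ffun 'I_K -> 'I_r.+1} := [ffun k => l k y].

Definition ace_array (R : realType) (X : Type) (r K N : nat)
    (l : 'I_K -> X -> 'I_r.+1) (c : 'I_N -> R) (x : 'I_N -> X)
    (j : {ffun 'I_K -> 'I_r.+1}) : R :=
  \sum_(i < N) c i * (lsh_tuple l (x i) == j)%:R.

Definition ace (R : realType) (X : Type) (r K N : nat)
    (l : 'I_K -> X -> 'I_r.+1) (c : 'I_N -> R) (x : 'I_N -> X) (q : X) : R :=
  ace_array l c x (lsh_tuple l q).

(* For an even number of values, the mean of the two middle ones. *)
Definition median (R : realType) (s : seq R) : R :=
  let t := sort <=%R s in
  (t`_((size t).-1)./2 + t`_((size t)./2)) / 2.

(* Median of g means, each over m values; it is 0 when g or m is 0. *)
Definition median_of_means (R : realType) (g m : nat)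
    (Z : 'I_g -> 'I_m -> R) : R :=
  median [seq (\sum_(u < m) Z t u) / m%:R | t <- enum 'I_g].

(* The LSH functions used by a sketch with d.+1 rows and w.+1 columns and by
   the g * m estimates of each cell: (row, column, group, place in group,
   coordinate of L). *)
Definition lsh_index (d w g m K : nat) : finType :=
  ('I_d.+1 * 'I_w.+1 * 'I_g * 'I_m * 'I_K)%type.

Definition race_cms_cell (R : realType) (X : Type) (r d w g m K N : nat)
    (h : 'I_d.+1 -> 'I_N -> 'I_w.+1)
    (l : lsh_index d w g m K -> X -> 'I_r.+1) (x : 'I_N -> X) (q : X)
    (a : 'I_d.+1) (b : 'I_w.+1) : R :=
  median_of_means (fun (t : 'I_g) (u : 'I_m) =>
    ace (fun k => l (a, b, t, u, k)) (fun i => (h a i == b)%:R) x q).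

Definition race_cms (R : realType) (X : Type) (r d w g m K N : nat)
    (h : 'I_d.+1 -> 'I_N -> 'I_w.+1)
    (l : lsh_index d w g m K -> X -> 'I_r.+1) (x : 'I_N -> X) (q : X)
    (i : 'I_N) : R :=
  let F a : R := race_cms_cell R h l x q a (h a i) in
  \big[Num.min/F ord0]_(a < d.+1) F a.

Definition race_cms_size (d w g m : nat) : nat := (d.+1 * w.+1 * (g * m))%N.

Definition mutually_independent (R : realType) (disp : measure_display)
    (T : measurableType disp) (P : probability T R) (I : finType)
    (F : I -> set (set T)) : Prop :=
  forall (J : {set I}) (A : I -> set T),
    (forall i, i \in J -> F i (A i)) ->
    P (\bigcap_(i in [set` J]) A i) = (\prod_(i in J) P (A i))%E.

Definition two_universal (R : realType) (disp : measure_display)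
    (T : measurableType disp) (P : probability T R) (N w : nat)
    (h : T -> 'I_N -> 'I_w.+1) : Prop :=
  forall i j : 'I_N, i != j ->
    (P [set o | h o i = h o j] <= (w.+1%:R^-1)%:E)%E.

Definition race_cms_draw (R : realType) (disp : measure_display)
    (T : measurableType disp) (P : probability T R) (X : Type)
    (r d w g m K N : nat) (mu : probability (funspace X r) R)
    (h : 'I_d.+1 -> {mfun T >-> funspace 'I_N w})
    (l : lsh_index d w g m K -> {mfun T >-> funspace X r}) : Prop :=
  [/\ forall a, two_universal P (h a),
      forall c (A : set (funspace X r)), measurable A ->
        distribution P (l c) A = mu A
    & mutually_independent P
        (fun c : 'I_d.+1 + lsh_index d w g m K =>
           match c with
           | inl a => g_sigma_algebra_preimage (h a)
           | inr c => g_sigma_algebra_preimage (l c)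
           end)].

(* The logarithm of O-bounds, which never drops below 1. *)
Definition ln_ge1 (R : realType) (y : R) : R := Num.max 1 (ln y).

(* The bound inside the O, with [lg] as logarithm. *)
Definition race_cms_bound (R : realType) (lg : R -> R) (N : nat)
    (s : 'I_N -> R) (eps delta : R) : R :=
  norm1 (sqrt_vec s) ^+ 2 * norm1 s / eps ^+ 3
  * lg (norm1 s / (eps * delta) * lg (N%:R / delta)) * lg (N%:R / delta).

(* Main.v *)
Require Import Defs.
From HB Require Import structures.
From mathcomp Require Import all_boot all_order all_algebra.
From mathcomp Require Import all_classical all_reals all_analysis.
From mathcomp Require Import zify ring lra.

(* The sketch sees the random functions only at finitely many points, so the
   joint law of what it sees is a product of distributions on finite types.
   An ACE estimate with coefficients in [0, 1] has mean sum_i c_i s_i and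
   second moment at most ||s~||_1^2.  By Chebyshev's inequality a mean over
   m ~ ||s~||_1^2 / eps^2 of them misses by eps/4 with probability at most
   e^-2 / 4; a median of g means can only miss when at least g/2 of them do,
   which by a union bound over the sets of failing groups has probability at
   most 2^g (e^-2 / 4)^(g/2) = e^-g.  By Markov's inequality, with
   w ~ ||s||_1 / eps columns each row overestimates s_i by more than eps/4
   with probability at most e^-1, so all d rows do so with probability at most
   e^-d.  Taking d ~ log (N / delta) and g ~ log (d w / delta) makes the total
   failure probability at most delta.

   The empty sketch, which returns 0, is accurate when s_i <= eps/2 for all i.
   Otherwise eps < 2 and eps/2 < ||s||_1 <= ||s~||_1^2, which absorbs the
   rounding of the parameters in the constant. *)

Set Implicit Arguments.
Unset Strict Implicit.
Unset Printing Implicit Defensive.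

Import Order.TTheory GRing.Theory Num.Theory.

Local Open Scope ring_scope.

(** * Finite probability *)

Section FiniteProbability.
Variable R : realFieldType.
Implicit Types I T : finType.

Definition is_distr T (p : T -> R) := (forall x, 0 <= p x) /\ \sum_x p x = 1.

Definition expect T (p F : T -> R) : R := \sum_x p x * F x.

Definition prob T (p : T -> R) (E : pred T) : R := expect p (fun x => (E x)%:R).

Definition prod_distr I T (p : I -> T -> R) (w : {ffun I -> T}) : R :=
  \prod_i p i (w i).

Section OneDistribution.
Variables (T : finType) (p : T -> R).
Hypothesis p_distr : is_distr p.

Lemma eq_expect (F G : T -> R) : F =1 G -> expect p F = expect p G.
Proof. by move=> FG; apply: eq_bigr => x _; rewrite FG. Qed.

Lemma expectD (F G : T -> R) :
  expect p (fun x => F x + G x) = expect p F + expect p G.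
Proof. by rewrite -big_split; apply: eq_bigr => x _ /=; rewrite mulrDr. Qed.

Lemma expectZ (a : R) (F : T -> R) :
  expect p (fun x => a * F x) = a * expect p F.
Proof. by rewrite mulr_sumr; apply: eq_bigr => x _; rewrite mulrCA. Qed.

Lemma expect_cst (a : R) : expect p (fun=> a) = a.
Proof. by rewrite /expect -mulr_suml p_distr.2 mul1r. Qed.

Lemma expect_sum I (P : pred I) (F : I -> T -> R) :
  expect p (fun x => \sum_(i | P i) F i x) = \sum_(i | P i) expect p (F i).
Proof. by rewrite exchange_big; apply: eq_bigr => x _; rewrite mulr_sumr. Qed.

Lemma le_expect (F G : T -> R) :
  (forall x, F x <= G x) -> expect p F <= expect p G.
Proof. by move=> FG; apply: ler_sum => x _; rewrite ler_wpM2l ?p_distr.1. Qed.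

Lemma expect_ge0 (F : T -> R) : (forall x, 0 <= F x) -> 0 <= expect p F.
Proof. by move=> F0; apply: sumr_ge0 => x _; rewrite mulr_ge0 ?p_distr.1. Qed.

Lemma prob_ge0 (E : pred T) : 0 <= prob p E.
Proof. by apply: expect_ge0 => x; rewrite ler0n. Qed.

Lemma le_prob (E E' : pred T) : subpred E E' -> prob p E <= prob p E'.
Proof.
move=> EE'; apply: le_expect => x; rewrite ler_nat.
by case: (boolP (E x)) => // /EE' ->.
Qed.

Lemma prob_le1 (E : pred T) : prob p E <= 1.
Proof.
by rewrite -(expect_cst 1); apply: le_expect => x; rewrite lern1 leq_b1.
Qed.

Lemma probC (E : pred T) : prob p (predC E) = 1 - prob p E.
Proof.
rewrite -[in RHS](expect_cst 1) -[LHS](addrK (prob p E)) -expectD.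
by congr (_ - _); apply: eq_expect => x /=; case: (E x);
  rewrite /= ?mulr0n ?mulr1n ?add0r ?addr0.
Qed.

Lemma prob_exists I (P : pred I) (E : I -> pred T) :
  prob p (fun x => [exists (i | P i), E i x]) <= \sum_(i | P i) prob p (E i).
Proof.
rewrite -expect_sum; apply: le_expect => x.
case: existsP => [[i /andP[Pi Ei]]|_]; last by apply: sumr_ge0.
by rewrite (bigD1 i) //= Ei lerDl; apply: sumr_ge0.
Qed.

Lemma markov_prob (F : T -> R) (t : R) : (forall x, 0 <= F x) -> 0 < t ->
  prob p (fun x => t < F x) <= expect p F / t.
Proof.
move=> F0 t0; rewrite ler_pdivlMr // mulrC -expectZ.
apply: le_expect => x; case: ltP => [/ltW|_]; first by rewrite mulr1.
by rewrite mulr0.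
Qed.

End OneDistribution.

(** * Product distributions: independence of the coordinates *)

Section Product.
Variables (I T : finType) (p : I -> T -> R).
Hypothesis p_distr : forall i, is_distr (p i).

(** Independence of the coordinates, obtained by distributing a product of sums into a sum over
    functions. *)
Lemma expect_prod_distr (F : I -> T -> R) :
  expect (prod_distr p) (fun w => \prod_i F i (w i)) =
  \prod_i expect (p i) (F i).
Proof.
by rewrite bigA_distr_bigA; apply: eq_bigr => w _; rewrite big_split.
Qed.

Lemma prod_distr_distr : is_distr (prod_distr p).
Proof.
split=> [w|]; first by apply: prodr_ge0 => i _; rewrite (p_distr i).1.
rewrite -bigA_distr_bigA big1 // => i _; exact: (p_distr i).2.
Qed.

Lemma expect_prod_distr_in (J : {set I}) (F : I -> T -> R) :
  expect (prod_distr p) (fun w => \prod_(i in J) F i (w i)) =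
  \prod_(i in J) expect (p i) (F i).
Proof.
transitivity (\prod_i expect (p i) (fun x => if i \in J then F i x else 1)).
  by rewrite -expect_prod_distr; apply: eq_expect => w; rewrite big_mkcond.
rewrite [RHS]big_mkcond; apply: eq_bigr => i _.
by case: ifP => // _; rewrite expect_cst.
Qed.

Lemma expect_marginal (i : I) (F : T -> R) :
  expect (prod_distr p) (fun w => F (w i)) = expect (p i) F.
Proof.
have := expect_prod_distr_in [set i] (fun=> F).
by rewrite big_set1 => <-; apply: eq_expect => w; rewrite big_set1.
Qed.

Lemma expect_marginal2 (i j : I) (F G : T -> R) : i != j ->
  expect (prod_distr p) (fun w => F (w i) * G (w j)) =
  expect (p i) F * expect (p j) G.
Proof.
move=> ij; have := expect_prod_distr_in [set i; j]
  (fun k => if k == i then F else G).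
have E (H : I -> R) : \prod_(k in [set i; j]) H k = H i * H j.
  by rewrite big_setU1 ?big_set1 // inE.
rewrite E eqxx eq_sym (negPf ij) => <-; apply: eq_expect => w.
by rewrite E eqxx eq_sym (negPf ij).
Qed.

Lemma prob_forall_in (J : {set I}) (E : I -> pred T) :
  prob (prod_distr p) (fun w => [forall i in J, E i (w i)]) =
  \prod_(i in J) prob (p i) (E i).
Proof.
rewrite -expect_prod_distr_in; apply: eq_expect => w.
case: forall_inP => [H|H]; first by rewrite big1 // => i /H ->.
have [i iJ /negPf Ei] : exists2 i, i \in J & ~~ E i (w i).
  apply/exists_inP; rewrite -negb_forall_in; apply/negP => /forall_inP; exact: H.
by rewrite (bigD1 i) //= Ei mul0r.
Qed.

Lemma prob_forall (E : I -> pred T) :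
  prob (prod_distr p) (fun w => [forall i, E i (w i)]) =
  \prod_i prob (p i) (E i).
Proof.
have := prob_forall_in [set: I] E.
rewrite [X in _ = X -> _](eq_bigl xpredT) => [<-|i]; last by rewrite inE.
by apply: eq_expect => w; congr ((nat_of_bool _)%:R);
  apply: eq_forallb => i; rewrite inE.
Qed.

End Product.

End FiniteProbability.

(** * Medians of means *)

(** If a sorted entry with index at least that of the lower middle were below [a], so would be all
    entries before it. The remaining ones, at most half of the list, could not contain the assumed
    strict majority. So both middle entries are at least [a]. *)
Lemma median_ge (R : realType) (s : seq R) (a : R) :
  (size s < (count (fun y : R => (a <= y)%R) s).*2)%N -> a <= median s.
Proof.
set t := sort <=%R s => maj.
pose P : pred R := fun y => a <= y; rewrite -/P in maj.
have st : size t = size s by rewrite size_sort.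
have t_sorted : sorted <=%R t by apply: sort_sorted => //; exact: le_total.
have cst : count P t = count P s by apply/permP; rewrite perm_sort.
have s_gt0 : (0 < size s)%N by have := count_size P s; lia.
have t_ge (i : nat) : ((size s).-1./2 <= i < size s)%N -> a <= t`_i.
  move=> /andP[i_ge i_lt]; rewrite leNgt; apply/negP => ti_lt.
  have : (count P (drop i.+1 t) <= size s - i.+1)%N.
    by rewrite -st -size_drop count_size.
  have : count P (take i.+1 t) = 0%N.
    apply/eqP; rewrite -leqn0 leqNgt -has_count -all_predC.
    apply/(all_nthP 0) => j; rewrite size_takel ?st // => ji.
    rewrite nth_take //= /P -ltNge; apply: le_lt_trans ti_lt.
    apply: (sorted_leq_nth le_trans le_refl) => //; rewrite inE st; lia.
  have := count_cat P (take i.+1 t) (drop i.+1 t).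
  rewrite cat_take_drop; lia.
rewrite /median -/t st.
have /t_ge h1 : ((size s).-1./2 <= (size s).-1./2 < size s)%N by lia.
have /t_ge h2 : ((size s).-1./2 <= (size s)./2 < size s)%N by lia.
lra.
Qed.

Lemma median_le (R : realType) (s : seq R) (b : R) :
  (size s < (count (fun y : R => (y <= b)%R) s).*2)%N -> median s <= b.
Proof.
set t := sort <=%R s => maj.
pose P : pred R := fun y => y <= b; rewrite -/P in maj.
have st : size t = size s by rewrite size_sort.
have t_sorted : sorted <=%R t by apply: sort_sorted => //; exact: le_total.
have cst : count P t = count P s by apply/permP; rewrite perm_sort.
have s_gt0 : (0 < size s)%N by have := count_size P s; lia.
have t_le (i : nat) : (i <= (size s)./2)%N -> t`_i <= b.
  move=> i_le; rewrite leNgt; apply/negP => ti_gt.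
  have : (count P (take i t) <= i)%N.
    by apply: leq_trans (count_size _ _) _; rewrite size_take_min geq_minl.
  have : count P (drop i t) = 0%N.
    apply/eqP; rewrite -leqn0 leqNgt -has_count -all_predC.
    apply/(all_nthP 0) => j; rewrite size_drop st => ji.
    rewrite nth_drop /= /P -ltNge; apply: lt_le_trans ti_gt _.
    apply: (sorted_leq_nth le_trans le_refl) => //; rewrite ?inE ?st; lia.
  have := count_cat P (take i t) (drop i t).
  rewrite cat_take_drop; lia.
rewrite /median -/t st.
have /t_le h1 : ((size s).-1./2 <= (size s)./2)%N by lia.
have /t_le h2 : ((size s)./2 <= (size s)./2)%N by lia.
lra.
Qed.

(** The values that do not miss form a strict majority, and they lie on the right side of both
    [c - e] and [c + e]. *)
Lemma norm_median_sub (R : realType) (g : nat) (F : 'I_g -> R) (c e : R) :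
  (#|[set t | (e < `|F t - c|)%R]|.*2 < g)%N ->
  `|median [seq F t | t <- enum 'I_g] - c| <= e.
Proof.
set B := [set t | _] => small.
have maj (P : pred R) : (forall t, t \notin B -> P (F t)) ->
    (size (map F (enum (ordinal g))) <
     (count P (map F (enum (ordinal g)))).*2)%N.
  move=> BP; rewrite size_map size_enum_ord count_map.
  have : (count (predC (mem B)) (enum 'I_g) <= count (preim F P) (enum 'I_g))%N.
    by apply: sub_count => t /= /BP.
  have := count_predC (mem B) (enum 'I_g).
  have -> : count (mem B) (enum 'I_g) = #|B|.
    by rewrite cardE enumT size_filter.
  rewrite size_enum_ord. lia.
have good t : t \notin B -> `|F t - c| <= e by rewrite inE -leNgt.
rewrite ler_distl; apply/andP; split.
  by apply: median_ge; apply: maj => t /good; rewrite ler_distl => /andP[].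
by apply: median_le; apply: maj => t /good; rewrite ler_distl => /andP[].
Qed.

(** A set [J] of groups fails entirely with probability at most [(rho / 2) ^ (2 |J|)], hence at most
    [(rho / 2) ^ g] when [2 |J| >= g]. There are at most [2 ^ g] such sets. The square in the
    hypothesis makes the exponent [2 |J|], so odd [g] needs no rounding. *)
Lemma prob_half_failures (R : realType) (T : finType) (p : T -> R) (g : nat)
    (E : pred T) (rho : R) :
  is_distr p -> 0 <= rho <= 1 -> prob p E <= (rho / 2) ^+ 2 ->
  prob (prod_distr (fun _ : 'I_g => p))
    (fun w => g <= #|[set t | E (w t)]|.*2)%N <= rho ^+ g.
Proof.
move=> p_distr /andP[rho_ge0 rho_le1] pE.
have q_distr := @prod_distr_distr _ 'I_g _ _ (fun=> p_distr).
set q := prod_distr _ in q_distr *.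
pose large (J : {set 'I_g}) := (g <= #|J|.*2)%N.
apply: (@le_trans _ _ (prob q (fun w => [exists (J | large J),
    [forall t in J, E (w t)]]))).
  apply: le_prob => // w /= gE; apply/existsP; exists [set t | E (w t)].
  by rewrite [large _]gE; apply/forall_inP => t; rewrite inE.
apply: le_trans (prob_exists q_distr _ _) _.
(* The sum is enlarged to all subsets, whose number is exactly [2 ^ g]. *)
apply: (@le_trans _ _ (\sum_(J in powerset [set: 'I_g]) (rho / 2) ^+ g));
  last first.
  rewrite sumr_const card_powerset cardsT card_ord.
  rewrite -[X in X <= _]mulr_natr natrX -exprMn.
  by rewrite mulfVK // pnatr_eq0.
rewrite [leLHS]big_mkcond [leRHS]big_mkcond /=; apply: ler_sum => J _.
rewrite powersetE finset.subsetT; case: ifP => [lJ|_];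
  last by rewrite exprn_ge0 // divr_ge0.
rewrite (@prob_forall_in _ _ _ (fun=> p) _ J (fun=> E)) // prodr_const.
apply: (@le_trans _ _ (((rho / 2) ^+ 2) ^+ #|J|)).
  by apply: lerXn2r => //; rewrite nnegrE ?sqr_ge0 // prob_ge0.
by rewrite -exprM mul2n; apply: ler_wiXn2l => //; lra.
Qed.

Section MedianOfMeans.
Variables (R : realType) (T : finType) (p : T -> R).
Hypothesis p_distr : is_distr p.

(** After centring, the off-diagonal terms of the expanded square vanish by independence. The [m]
    diagonal ones each equal the variance, which is at most the second moment. *)
Lemma expect_sqr_mean (m : nat) (F : T -> R) : (0 < m)%N ->
  expect (prod_distr (fun _ : 'I_m => p))
    (fun w => ((\sum_u F (w u)) / m%:R - expect p F) ^+ 2)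
  <= expect p (fun x => F x ^+ 2) / m%:R.
Proof.
move=> m_gt0; have m0 : m%:R != 0 :> R by rewrite pnatr_eq0 -lt0n.
pose G x := F x + - expect p F.
have EG : expect p G = 0 by rewrite expectD expect_cst // subrr.
have EG2 : expect p (fun x => G x * G x) <= expect p (fun x => F x ^+ 2).
  have -> : expect p (fun x => G x * G x) =
      expect p (fun x => F x ^+ 2 + (- (2 * expect p F) * F x + expect p F ^+ 2)).
    by apply: eq_expect => x; rewrite /G; ring.
  rewrite expectD expectD expectZ expect_cst //.
  have := sqr_ge0 (expect p F); lra.
set q := prod_distr _; have q_distr : is_distr q by exact: prod_distr_distr.
have sqrE (w : {ffun 'I_m -> T}) :
    ((\sum_(u < m) F (w u)) / m%:R - expect p F) ^+ 2 =
    m%:R^-1 ^+ 2 * \sum_u \sum_v G (w u) * G (w v).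
  have -> : \sum_(u < m) \sum_(v < m) G (w u) * G (w v) =
      (\sum_(u < m) G (w u)) ^+ 2.
    by rewrite expr2 mulr_suml; apply: eq_bigr => u _; rewrite mulr_sumr.
  rewrite -exprMn; congr (_ ^+ 2).
  rewrite /G big_split /= sumr_const card_ord -mulr_natr; field.
  by rewrite m0.
rewrite (eq_expect _ sqrE) expectZ expect_sum.
have cross u : expect q (fun w => \sum_v G (w u) * G (w v)) =
    expect p (fun x => G x * G x).
  rewrite expect_sum (bigD1 u) //= big1 => [|v vu]; last first.
    by rewrite expect_marginal2 // 1?eq_sym // EG mul0r.
  by rewrite addr0 (@expect_marginal _ _ _ (fun=> p) _ u (fun x => G x * G x)).
rewrite (eq_bigr _ (fun u _ => cross u)) sumr_const card_ord.
rewrite -[X in _ * X <= _]mulr_natr.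
rewrite [X in X <= _](_ : _ = expect p (fun x => G x * G x) / m%:R).
  by rewrite ler_wpM2r // invr_ge0.
by field; rewrite m0.
Qed.

Lemma chebyshev_mean (m : nat) (F : T -> R) (e : R) : (0 < m)%N -> 0 < e ->
  prob (prod_distr (fun _ : 'I_m => p))
    (fun w => e < `|(\sum_u F (w u)) / m%:R - expect p F|)
  <= expect p (fun x => F x ^+ 2) / (m%:R * e ^+ 2).
Proof.
move=> m_gt0 e_gt0; have q_distr := @prod_distr_distr _ 'I_m _ _ (fun=> p_distr).
have e2_gt0 : 0 < e ^+ 2 by rewrite exprn_gt0.
rewrite invfM mulrA -[leRHS]/(_ / _).
apply: (@le_trans _ _ (expect (prod_distr (fun _ : 'I_m => p))
    (fun w => ((\sum_u F (w u)) / m%:R - expect p F) ^+ 2) / e ^+ 2)); last first.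
  by rewrite ler_pM2r ?invr_gt0 // expect_sqr_mean.
apply: le_trans (markov_prob q_distr _ e2_gt0) => [|w]; last exact: sqr_ge0.
apply: le_prob => // w /= lt_e.
rewrite -[X in _ < X]real_normK ?num_real //.
by rewrite ltr_pXn2r // ?nnegrE ?normr_ge0 // ltW.
Qed.

(** The median can miss by more than [e] only if at least half of the means do, and Chebyshev's
    inequality bounds the failure of one mean. *)
Lemma prob_median_of_means (g m : nat) (F : T -> R) (e rho : R) :
  (0 < m)%N -> 0 < e -> 0 <= rho <= 1 ->
  expect p (fun x => F x ^+ 2) / (m%:R * e ^+ 2) <= (rho / 2) ^+ 2 ->
  prob (prod_distr (fun _ : 'I_g => prod_distr (fun _ : 'I_m => p)))
    (fun w => e < `|median_of_means (fun t u => F (w t u)) - expect p F|)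
  <= rho ^+ g.
Proof.
move=> m_gt0 e_gt0 rho01 small.
have q_distr := @prod_distr_distr _ 'I_m _ _ (fun=> p_distr).
have qg_distr := @prod_distr_distr _ 'I_g _ _ (fun=> q_distr).
have := @chebyshev_mean m F e m_gt0 e_gt0 => /le_trans /(_ small) cheb.
pose far (v : {ffun 'I_m -> T}) :=
  e < `|(\sum_u F (v u)) / m%:R - expect p F|.
have {}cheb : prob (prod_distr (fun _ : 'I_m => p)) far <= (rho / 2) ^+ 2.
  exact: cheb.
apply: le_trans (prob_half_failures g q_distr rho01 cheb).
apply: le_prob => // w /=; apply: contraTT; rewrite -ltnNge -leNgt.
exact: norm_median_sub.
Qed.
End MedianOfMeans.

(** * ACE and Count-Min estimates *)

(** [x_i] contributes to the bucket of the query exactly when all [K] coordinates collide. *)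
Lemma aceE (R : realType) (X : Type) (r K N : nat) (l : 'I_K -> X -> 'I_r.+1)
    (c : 'I_N -> R) (x : 'I_N -> X) (q : X) :
  ace l c x q = \sum_i c i * [forall k, l k (x i) == l k q]%:R.
Proof.
apply: eq_bigr => i _; congr (_ * (nat_of_bool _)%:R).
apply/eqP/forallP => [/ffunP H k|H]; first by have := H k; rewrite !ffunE => ->.
by apply/ffunP => k; rewrite !ffunE; apply/eqP.
Qed.

Section Ace.
Variables (R : realType) (r K N : nat).
Local Notation V := {ffun option 'I_N -> 'I_r.+1}.
Variable p : V -> R.
Hypothesis p_distr : is_distr p.

(* [Some i] stands for the data point x_i and [None] for the query. *)
Definition collision (i : 'I_N) : pred V := fun v => v (Some i) == v None.

Definition collision_pow (i : 'I_N) : R := prob p (collision i) ^+ K.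

(** Here [option 'I_N] itself is the space of points, so each LSH function is a finite vector of
    buckets. *)
Definition ace_value (c : 'I_N -> R) (v : {ffun 'I_K -> V}) : R :=
  ace (fun k => v k) c Some None.

Lemma prob_all_collide (i : 'I_N) :
  prob (prod_distr (fun _ : 'I_K => p))
    (fun v => [forall k, collision i (v k)]) = collision_pow i.
Proof.
by rewrite (@prob_forall _ _ _ (fun=> p) _ (fun=> collision i)) //
  prodr_const card_ord.
Qed.

Lemma collision_pow_ge0 (i : 'I_N) : 0 <= collision_pow i.
Proof. by rewrite exprn_ge0 // prob_ge0. Qed.

Lemma collision_pow_le1 (i : 'I_N) : collision_pow i <= 1.
Proof. by rewrite exprn_ile1 ?prob_ge0 ?prob_le1. Qed.

Lemma expect_ace (c : 'I_N -> R) :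
  expect (prod_distr (fun _ : 'I_K => p)) (ace_value c) =
  \sum_i c i * collision_pow i.
Proof.
rewrite (eq_expect _ (fun v =>
  aceE (fun k => (v : {ffun 'I_K -> V}) k) c Some None)).
rewrite expect_sum; apply: eq_bigr => i _.
by rewrite expectZ -prob_all_collide.
Qed.

(* Pr[L(x_i) = L(q) = L(x_j)] is at most min(s_i, s_j), hence at most the
   geometric mean of s_i and s_j. *)
Lemma expect_ace_sqr (c : 'I_N -> R) : (forall i, 0 <= c i <= 1) ->
  expect (prod_distr (fun _ : 'I_K => p)) (fun v => ace_value c v ^+ 2)
  <= norm1 (sqrt_vec collision_pow) ^+ 2.
Proof.
move=> c01; have q_distr := @prod_distr_distr _ 'I_K _ _ (fun=> p_distr).
pose B i (v : {ffun 'I_K -> V}) : R := [forall k, collision i (v k)]%:R.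
have B01 i v : 0 <= B i v <= 1 by rewrite ler0n lern1 leq_b1.
have EB i : expect (prod_distr (fun _ : 'I_K => p)) (B i) = collision_pow i.
  exact: prob_all_collide.
(* Coefficients in [[0, 1]] only shrink the sum of collision indicators, so they may be replaced by
   1. *)
apply: (@le_trans _ _ (expect (prod_distr (fun _ : 'I_K => p))
    (fun v => \sum_i \sum_j B i v * B j v))).
  apply: le_expect => // v.
  have -> : \sum_i \sum_j B i v * B j v = (\sum_i B i v) ^+ 2.
    by rewrite expr2 mulr_suml; apply: eq_bigr => u _; rewrite mulr_sumr.
  rewrite [ace_value _ _]aceE.
  have /andP[? ?] : 0 <= \sum_i c i * B i v <= \sum_i B i v.
    apply/andP; split.
      apply: sumr_ge0 => i _; have /andP[? _] := c01 i; have /andP[? _] := B01 i v.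
      exact: mulr_ge0.
    apply: ler_sum => i _; have /andP[? ?] := c01 i; have /andP[? _] := B01 i v.
    by rewrite ler_piMl.
  apply: lerXn2r => //; rewrite nnegrE //.
  by apply: (@le_trans _ _ (\sum_i c i * B i v)).
rewrite expect_sum.
have -> : norm1 (sqrt_vec collision_pow) ^+ 2 = \sum_i \sum_j
    Num.sqrt (collision_pow i) * Num.sqrt (collision_pow j).
  rewrite /norm1 expr2 mulr_suml; apply: eq_bigr => i _; rewrite mulr_sumr.
  by apply: eq_bigr => j _; rewrite !ger0_norm ?sqrtr_ge0.
apply: ler_sum => i _; rewrite expect_sum; apply: ler_sum => j _.
have le_i : expect (prod_distr (fun _ : 'I_K => p)) (fun v => B i v * B j v)
    <= Num.sqrt (collision_pow i) * Num.sqrt (collision_pow i).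
  rewrite -expr2 sqr_sqrtr ?collision_pow_ge0 // -EB; apply: le_expect => // v.
  have /andP[? ?] := B01 i v; have /andP[? ?] := B01 j v; exact: ler_piMr.
have le_j : expect (prod_distr (fun _ : 'I_K => p)) (fun v => B i v * B j v)
    <= Num.sqrt (collision_pow j) * Num.sqrt (collision_pow j).
  rewrite -expr2 sqr_sqrtr ?collision_pow_ge0 // -EB; apply: le_expect => // v.
  have /andP[? ?] := B01 i v; have /andP[? ?] := B01 j v; exact: ler_piMl.
have [ij|/ltW ji] := leP (Num.sqrt (collision_pow i)) (Num.sqrt (collision_pow j)).
  by apply: le_trans le_i _; rewrite ler_wpM2l ?sqrtr_ge0.
by apply: le_trans le_j _; rewrite ler_wpM2r ?sqrtr_ge0.
Qed.

End Ace.

(** * Count-Min Sketch of a nonnegative vector *)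

Section CountMin.
Variables (R : realType) (N w : nat) (s : 'I_N -> R).
Hypothesis s_ge0 : forall i, 0 <= s i.
Local Notation H := {ffun 'I_N -> 'I_w.+1}.

Definition count_cell (f : 'I_N -> 'I_w.+1) (b : 'I_w.+1) : R :=
  \sum_j (f j == b)%:R * s j.

Lemma count_cell_ge (f : 'I_N -> 'I_w.+1) (i : 'I_N) :
  s i <= count_cell f (f i).
Proof.
rewrite /count_cell (bigD1 i) //= eqxx mul1r lerDl.
by apply: sumr_ge0 => j _; rewrite mulr_ge0.
Qed.

(** The excess of the cell over [s i] is the mass of the other items hashed to it. By 2-universality
    its mean is at most [norm1 s / w.+1], and Markov's inequality applies. *)
Lemma prob_count_cell (p : H -> R) (i : 'I_N) (t : R) :
  is_distr p ->
  (forall i j, i != j -> prob p (fun f => f i == f j) <= w.+1%:R^-1) ->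
  0 < t ->
  prob p (fun f => s i + t < count_cell f (f i)) <= norm1 s / w.+1%:R / t.
Proof.
move=> p_distr p_univ t_gt0.
pose F (f : H) := \sum_(j | j != i) s j * (f j == f i)%:R.
have F_ge0 f : 0 <= F f by apply: sumr_ge0 => j _; rewrite mulr_ge0.
have cellE (f : H) : count_cell f (f i) = s i + F f.
  rewrite /count_cell (bigD1 i) //= eqxx mul1r; congr (_ + _).
  by apply: eq_bigr => j _; rewrite mulrC.
apply: (@le_trans _ _ (prob p (fun f => t < F f))).
  by apply: le_prob => // f /=; rewrite cellE ltrD2l.
apply: le_trans (markov_prob p_distr F_ge0 t_gt0) _.
(* The sum over [j != i] is compared with the full norm term by term; the term [i] is bounded below
   by 0. *)
rewrite ler_pM2r ?invr_gt0 // expect_sum /norm1 mulr_suml big_mkcond /=.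
apply: ler_sum => j _; rewrite (ger0_norm (s_ge0 j)); case: ifPn => [ji|_].
  by rewrite expectZ ler_wpM2l // p_univ.
by rewrite mulr_ge0 // invr_ge0.
Qed.

(** Independent rows give the power [d.+1]; the union bound over the items gives the factor [N]. *)
Lemma prob_count_min (d : nat) (p : 'I_d.+1 -> H -> R) (t rho : R) :
  (forall a, is_distr (p a)) ->
  (forall a i j, i != j -> prob (p a) (fun f => f i == f j) <= w.+1%:R^-1) ->
  0 < t -> norm1 s / w.+1%:R / t <= rho ->
  prob (prod_distr p) (fun h => [exists i, [forall a,
    s i + t < count_cell (h a) (h a i)]]) <= N%:R * rho ^+ d.+1.
Proof.
move=> p_distr p_univ t_gt0 small.
apply: le_trans (prob_exists (prod_distr_distr p_distr) xpredT _) _.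
rewrite mulr_natl -[in X in _ *+ X](card_ord N) -sumr_const.
apply: ler_sum => i _.
pose E (a : 'I_d.+1) (f : H) := s i + t < count_cell f (f i).
rewrite (@prob_forall _ _ _ _ p_distr E).
rewrite -[X in rho ^+ X]card_ord -prodr_const; apply: ler_prod => a _.
rewrite prob_ge0 //=.
by apply: le_trans small; apply: prob_count_cell => // j k; exact: p_univ.
Qed.

End CountMin.

(** * The combined sketch over finite probability spaces *)

Section RaceCms.
Variables (R : realType) (r d w g m K N : nat).
Local Notation V := {ffun option 'I_N -> 'I_r.+1}.
Local Notation H := {ffun 'I_N -> 'I_w.+1}.
Local Notation Z := {ffun 'I_g -> {ffun 'I_m -> {ffun 'I_K -> V}}}.
Variables (p : V -> R) (ph : 'I_d.+1 -> H -> R).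
Hypothesis p_distr : is_distr p.
Hypothesis ph_distr : forall a, is_distr (ph a).
Hypothesis ph_univ : forall a i j, i != j ->
  prob (ph a) (fun f => f i == f j) <= w.+1%:R^-1.

Local Notation s := (collision_pow K p).

(** The product is iterated over cells, groups, places and coordinates, so that the bounds for one
    ACE estimate, one mean and one median apply layer by layer. *)
Definition lsh_distr : {ffun 'I_d.+1 * 'I_w.+1 -> Z} -> R :=
  prod_distr (fun _ : 'I_d.+1 * 'I_w.+1 => prod_distr (fun _ : 'I_g =>
    prod_distr (fun _ : 'I_m => prod_distr (fun _ : 'I_K => p)))).

Definition recovery (h : {ffun 'I_d.+1 -> H})
    (z : {ffun 'I_d.+1 * 'I_w.+1 -> Z})
    (i : 'I_N) : R :=
  race_cms R (fun a => h a)
    (fun c : lsh_index d w g m K => z c.1.1.1 c.1.1.2 c.1.2 c.2) Some None i.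

Definition cell_estimate (f : H) (b : 'I_w.+1) (z : Z) : R :=
  median_of_means (fun t u => ace_value (fun i => (f i == b)%:R) (z t u)).

Lemma lsh_distr_distr : is_distr lsh_distr.
Proof. by do 4!apply: prod_distr_distr => ?. Qed.

(** For the lower bound every row matters, and no Count-Min cell underestimates. For the upper bound
    one good row suffices: it costs [t] for hash collisions and [t] for the estimation of its
    cell. *)
Lemma recovery_accurate (t : R) (h : {ffun 'I_d.+1 -> H})
    (z : {ffun 'I_d.+1 * 'I_w.+1 -> Z}) (i : 'I_N) :
  (exists a, count_cell s (h a) (h a i) <= s i + t) ->
  (forall ab, `|cell_estimate (h ab.1) ab.2 (z ab) -
                count_cell s (h ab.1) ab.2| <= t) ->
  s i - t <= recovery h z i <= s i + (t + t).
Proof.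
move=> [a a_le] close; apply/andP; split.
  suff ge a' : s i - t <= cell_estimate (h a') (h a' i) (z (a', h a' i)).
    (* The default of the minimum, the value of row [ord0], must satisfy the bound as well. *)
    by apply: le_bigmin => [|a0 _]; exact: ge.
  have := close (a', h a' i); rewrite ler_distl => /andP[+ _] /=.
  have := count_cell_ge (collision_pow_ge0 K p_distr) (h a') i; lra.
apply: (@le_trans _ _ (cell_estimate (h a) (h a i) (z (a, h a i)))).
  exact: bigmin_le.
have := close (a, h a i); rewrite ler_distl => /andP[_ +] /=.
lra.
Qed.

(** The coefficients select the items hashed to [b], so the mean of the ACE estimate is the
    Count-Min cell. They lie in [[0, 1]], so one second-moment bound serves all cells. *)
Lemma prob_cell_estimate (f : H) (b : 'I_w.+1) (e rho : R) :
  (0 < m)%N -> 0 < e -> 0 <= rho <= 1 ->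
  norm1 (sqrt_vec s) ^+ 2 / (m%:R * e ^+ 2) <= (rho / 2) ^+ 2 ->
  prob (prod_distr (fun _ : 'I_g =>
    prod_distr (fun _ : 'I_m => prod_distr (fun _ : 'I_K => p))))
    (fun z => e < `|cell_estimate f b z - count_cell s f b|) <= rho ^+ g.
Proof.
move=> m_gt0 e_gt0 rho01 small.
rewrite /count_cell -(expect_ace K p_distr); apply: prob_median_of_means => //.
  exact: prod_distr_distr.
apply: le_trans small; rewrite ler_wpM2r //.
  by rewrite invr_ge0 mulr_ge0 // sqr_ge0.
by apply: expect_ace_sqr => // i; rewrite ler0n lern1 leq_b1.
Qed.

(** Condition on the hash functions. If some item is bad in every row, the failure probability is
    bounded by 1. Otherwise recovery fails only if some cell estimate is off. The union bound runs
    over all cells of the array, which brings in their number instead of [N]. *)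
Lemma prob_recovery (t rho : R) :
  (0 < m)%N -> 0 < t -> 0 <= rho <= 1 ->
  norm1 s / w.+1%:R / t <= rho ->
  norm1 (sqrt_vec s) ^+ 2 / (m%:R * t ^+ 2) <= (rho / 2) ^+ 2 ->
  expect (prod_distr ph) (fun h => prob lsh_distr (fun z =>
    ~~ [forall i, s i - (t + t) <= recovery h z i <= s i + (t + t)]))
  <= N%:R * rho ^+ d.+1 + (d.+1 * w.+1)%:R * rho ^+ g.
Proof.
move=> m_gt0 t_gt0 rho01 small_cms small_ace.
have ph_prod_distr := prod_distr_distr ph_distr.
pose bad (h : {ffun 'I_d.+1 -> H}) := [exists i, [forall a,
  s i + t < count_cell s (h a) (h a i)]].
apply: (@le_trans _ _ (expect (prod_distr ph) (fun h =>
    (bad h)%:R + (d.+1 * w.+1)%:R * rho ^+ g))); last first.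
  rewrite expectD expect_cst // lerD2r.
  by apply: prob_count_min => // i; exact: collision_pow_ge0.
apply: le_expect => // h.
have [bad_h|good_h] := boolP (bad h).
  apply: le_trans (prob_le1 lsh_distr_distr _) _.
  by rewrite lerDl mulr_ge0 // exprn_ge0 //; case/andP: rho01.
rewrite add0r.
pose far (ab : 'I_d.+1 * 'I_w.+1) (z : Z) := t <
  `|cell_estimate (h ab.1) ab.2 z - count_cell s (h ab.1) ab.2|.
apply: (@le_trans _ _ (prob lsh_distr (fun z => [exists ab, far ab (z ab)]))).
  apply: (le_prob lsh_distr_distr) => z /=; apply: contraR => /existsPn near.
  apply/forallP => i.
  have /existsPn /(_ i) /forallPn [a] := good_h; rewrite -leNgt => a_le.
  have := @recovery_accurate t h z i (ex_intro _ a a_le).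
  have near' ab : `|cell_estimate (h ab.1) ab.2 (z ab) -
      count_cell s (h ab.1) ab.2| <= t by have := near ab; rewrite -leNgt.
  move=> /(_ near') /andP[? ->]; rewrite andbT; lra.
apply: le_trans (prob_exists lsh_distr_distr xpredT
  (fun ab z => far ab (z ab))) _.
rewrite mulr_natl.
have -> : (d.+1 * w.+1)%N = #|{: 'I_d.+1 * 'I_w.+1}|
  by rewrite card_prod !card_ord.
rewrite -sumr_const; apply: ler_sum => ab _.
(* The event concerns the single coordinate [ab], so only its marginal matters. *)
rewrite /prob (@expect_marginal _ _ _ _ _ ab (fun z => (far ab z)%:R)).
  exact: prob_cell_estimate.
by move=> _; do 3!apply: prod_distr_distr => ?.
Qed.

End RaceCms.

Local Open Scope classical_set_scope.
Local Open Scope ring_scope.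

(** * Reduction to finite types *)

Section FiniteLaw.
Variables (R : realType) (disp : measure_display) (T : measurableType disp).
Variables (P : probability T R) (S : finType) (Y : T -> S).
Hypothesis mY : forall s, measurable [set o | Y o = s].

Definition law (s : S) : R := fine (P [set o | Y o = s]).

Lemma probability_preimage (E : pred S) :
  P [set o | E (Y o)] = (prob law E)%:E.
Proof.
have -> : [set o | E (Y o)] =
    \bigcup_(s in [set` enum E]) [set o | Y o = s].
  apply/seteqP; split=> [t Et|t [s /=]]; first by exists (Y t);
    rewrite /= ?mem_enum.
  by rewrite mem_enum => Es ->.
rewrite measure_fin_bigcup //; last by move=> s t _ _ [t0 [/= <- <-]].
rewrite -fsbig_seq ?enum_uniq // big_enum /= /prob /expect -sumEFin.
rewrite [LHS]big_mkcond /=.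
apply: eq_bigr => s _; rewrite -[s \in E]/(E s).
case: (E s); last by rewrite mulr0.
by rewrite mulr1 fineK // fin_num_measure.
Qed.

Lemma law_distr : is_distr law.
Proof.
split=> [s|]; first by apply: fine_ge0.
apply: EFin_inj; rewrite -(probability_setT P).
rewrite [X in P X](_ : _ = [set o | predT (Y o)]); last by apply/seteqP; split.
rewrite probability_preimage; congr (_%:E).
by apply: eq_bigr => s _; rewrite mulr1.
Qed.

End FiniteLaw.

Definition restrict (X : Type) (r : nat) (I : finType) (pt : I -> X)
  (f : X -> 'I_r.+1) : {ffun I -> 'I_r.+1} := [ffun y => f (pt y)].

(** The fibre is a finite intersection of the evaluation events that generate the sigma-algebra. *)
Lemma measurable_restrict (X : Type) (r : nat) (I : finType) (pt : I -> X)
    (v : {ffun I -> 'I_r.+1}) :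
  measurable ([set f | restrict pt f = v] : set (funspace X r)).
Proof.
have -> : [set f | restrict pt f = v] =
    \bigcap_(i in [set: I]) [set f : X -> 'I_r.+1 | f (pt i) = v i].
  apply/seteqP; split=> [f /= <- i _|f H] /=; first by rewrite ffunE.
  by apply/ffunP => i; rewrite ffunE; exact: H.
apply: (@fin_bigcap_measurable _ (funspace X r)) => // i _.
by apply: sub_sigma_algebra; exists (pt i, v i).
Qed.

(** * Joint law of what the sketch observes *)

Section Draw.
Variables (R : realType) (disp : measure_display) (T : measurableType disp).
Variables (P : probability T R) (X : Type) (r d w g m K N : nat).
Variables (mu : probability (funspace X r) R) (x : 'I_N -> X) (q : X).
Variables (h : 'I_d.+1 -> {mfun T >-> funspace 'I_N w}).
Variable l : lsh_index d w g m K -> {mfun T >-> funspace X r}.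
Hypothesis hl_draw : race_cms_draw P mu h l.
Local Notation V := {ffun option 'I_N -> 'I_r.+1}.
Local Notation H := {ffun 'I_N -> 'I_w.+1}.
Local Notation Z := {ffun 'I_g -> {ffun 'I_m -> {ffun 'I_K -> V}}}.

Definition points (y : option 'I_N) : X := oapp x q y.

Definition lsh_law : V -> R := law mu (restrict points).

Definition hash_obs (a : 'I_d.+1) (o : T) : H := restrict id (h a o).

Definition hash_law (a : 'I_d.+1) : H -> R := law P (hash_obs a).

(** All the randomness that the output depends on: the hash functions, and the LSH functions
    restricted to the data points and the query. *)
Definition sketch_obs (o : T) :
    {ffun 'I_d.+1 -> H} * {ffun 'I_d.+1 * 'I_w.+1 -> Z} :=
  ([ffun a => hash_obs a o],
   [ffun ab => [ffun t => [ffun u => [ffun k =>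
      restrict points (l (ab, t, u, k) o)]]]]).

Lemma lsh_law_distr : is_distr lsh_law.
Proof. by apply: law_distr => v; exact: measurable_restrict. Qed.

Lemma measurable_hash_obs (a : 'I_d.+1) (f : H) :
  measurable [set o | hash_obs a o = f].
Proof. exact: (measurable_funPTI (h a) (measurable_restrict id f)). Qed.

Lemma hash_law_distr (a : 'I_d.+1) : is_distr (hash_law a).
Proof. exact/law_distr/measurable_hash_obs. Qed.

Lemma hash_law_universal (a : 'I_d.+1) (i j : 'I_N) : i != j ->
  prob (hash_law a) (fun f => f i == f j) <= w.+1%:R^-1.
Proof.
case: hl_draw => univ _ _ /(univ a); rewrite -lee_fin.
rewrite -(probability_preimage P (measurable_hash_obs a)).
congr (P _ <= _)%E; apply/seteqP; split=> o /=; rewrite !ffunE.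
  by move=> ->.
by move/eqP.
Qed.

Lemma similarityE (i : 'I_N) :
  similarity mu K x q i = collision_pow K lsh_law i.
Proof.
congr (_ ^+ K); rewrite /collision_probability.
rewrite [X in mu X](_ : _ = [set f | collision i (restrict points f)]).
  by rewrite (probability_preimage mu (measurable_restrict points)).
apply/seteqP; split=> f /=; rewrite /collision !ffunE /=; first by move=> ->.
by move/eqP.
Qed.

(** The constraint that one random function puts on the observation. The index type is that of the
    family in the independence hypothesis. *)
Definition sketch_component
    (hz : {ffun 'I_d.+1 -> H} * {ffun 'I_d.+1 * 'I_w.+1 -> Z})
    (c : 'I_d.+1 + lsh_index d w g m K) : set T :=
  match c with
  | inl a => [set o | hash_obs a o = hz.1 a]
  | inr c => [set o | restrict points (l c o) =
                      hz.2 c.1.1.1 c.1.1.2 c.1.2 c.2]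
  end.

Lemma sketch_fiberE hz : [set o | sketch_obs o = hz] =
  \bigcap_(c in [set` ([set: 'I_d.+1 + lsh_index d w g m K]%SET)])
    sketch_component hz c.
Proof.
case: hz => f z; apply/seteqP; split=> o /=.
  move=> [<- <-] [a|[[[ab t] u] k]] _ /=; first by rewrite ffunE.
  by rewrite !ffunE.
move=> fz; congr pair; apply/ffunP.
  by move=> a; rewrite ffunE; apply: (fz (inl a)); rewrite /= inE.
move=> ab; apply/ffunP => t; apply/ffunP => u; apply/ffunP => k.
by rewrite !ffunE; apply: (fz (inr (ab, t, u, k))); rewrite /= inE.
Qed.

Lemma measurable_sketch_component hz c : measurable (sketch_component hz c).
Proof.
case: c => [a|c] /=; first exact: measurable_hash_obs.
exact: (measurable_funPTI (l c) (measurable_restrict points _)).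
Qed.

Lemma measurable_sketch_obs hz : measurable [set o | sketch_obs o = hz].
Proof.
rewrite sketch_fiberE; apply: fin_bigcap_measurable => // c _.
exact: measurable_sketch_component.
Qed.

(** The fibre over [hz] is an intersection of one event per random function, so mutual independence
    over the whole index set factors its probability. *)
Lemma law_sketch_obs hz :
  law P sketch_obs hz = prod_distr hash_law hz.1 * lsh_distr lsh_law hz.2.
Proof.
case: hl_draw => _ l_law indep.
rewrite /law sketch_fiberE indep => [|[a|c] _]; last first.
- exists [set f | restrict points f = hz.2 c.1.1.1 c.1.1.2 c.1.2 c.2].
    exact: measurable_restrict.
  by rewrite setTI.
- exists [set f | restrict id f = hz.1 a]; first exact: measurable_restrict.
  by rewrite setTI.
rewrite (eq_bigr (fun c => (fine (P (sketch_component hz c)))%:E)); last first.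
  by move=> c _; rewrite fineK // fin_num_measure //;
    exact: measurable_sketch_component.
rewrite prodEFin /= (eq_bigl xpredT) => [|c]; last by rewrite inE.
rewrite big_sumType /=; congr (_ * _).
(* The iterated product is flattened to one over [lsh_index]. *)
rewrite /lsh_distr /prod_distr !pair_bigA /=; apply: eq_bigr => c _.
rewrite /lsh_law /law -(l_law c) //; exact: measurable_restrict.
Qed.

Lemma race_cms_obs (o : T) (i : 'I_N) :
  race_cms R (fun a => h a o) (fun c => l c o) x q i =
  recovery R (sketch_obs o).1 (sketch_obs o).2 i.
Proof.
have hE : (fun a => h a o : 'I_N -> 'I_w.+1) =
    (fun a => (sketch_obs o).1 a : 'I_N -> 'I_w.+1).
  by apply/funext => a; apply/funext => j; rewrite /= !ffunE.
rewrite /recovery -hE.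
have cellE a b : race_cms_cell R (fun a => h a o) (fun c => l c o) x q a b =
    race_cms_cell R (fun a => h a o)
      (fun c : lsh_index d w g m K =>
         (sketch_obs o).2 c.1.1.1 c.1.1.2 c.1.2 c.2)
      Some None a b.
  congr median_of_means; apply/funext => t; apply/funext => u.
  rewrite !aceE; apply: eq_bigr => j _; congr (_ * (nat_of_bool _)%:R).
  by apply: eq_forallb => k; rewrite /= !ffunE.
by rewrite /race_cms; under eq_bigr do rewrite cellE; rewrite cellE.
Qed.

Lemma race_cms_accurate (t rho : R) :
  (0 < m)%N -> 0 < t -> 0 <= rho <= 1 ->
  norm1 (similarity mu K x q) / w.+1%:R / t <= rho ->
  norm1 (sqrt_vec (similarity mu K x q)) ^+ 2 / (m%:R * t ^+ 2)
    <= (rho / 2) ^+ 2 ->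
  ((1 - (N%:R * rho ^+ d.+1 + (d.+1 * w.+1)%:R * rho ^+ g))%:E <=
   P [set o | forall i : 'I_N,
         (similarity mu K x q i - (t + t)
         <= race_cms R (fun a => h a o) (fun c => l c o) x q i
         <= similarity mu K x q i + (t + t))%R])%E.
Proof.
have -> : similarity mu K x q = collision_pow K lsh_law.
  by apply/funext => i; exact: similarityE.
move=> m_gt0 t_gt0 rho01 small_cms small_ace.
set s := collision_pow K lsh_law in small_cms small_ace *.
pose good (hz : {ffun 'I_d.+1 -> H} * {ffun 'I_d.+1 * 'I_w.+1 -> Z}) :=
  [forall i, s i - (t + t) <= recovery R hz.1 hz.2 i <= s i + (t + t)].
rewrite [X in P X](_ : _ = [set o | good (sketch_obs o)]); last first.
  apply/seteqP; split=> o /= Ho; first by apply/forallP => i;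
    rewrite -race_cms_obs.
  by move=> i; rewrite race_cms_obs; exact: (forallP Ho i).
rewrite (probability_preimage P measurable_sketch_obs) lee_fin.
have sk_distr := law_distr P measurable_sketch_obs.
rewrite lerBlDr -lerBlDl -(probC sk_distr).
have := (@prob_recovery R r d w g m K N _ _ lsh_law_distr hash_law_distr
  hash_law_universal
  t rho m_gt0 t_gt0 rho01 small_cms small_ace).
apply: le_trans.
(* As the joint law factors, the failure probability equals the expectation over the hash functions
   of the conditional one. *)
rewrite le_eqVlt; apply/orP; left; apply/eqP.
rewrite /prob /expect.
under [RHS]eq_bigr do rewrite mulr_sumr.
rewrite pair_bigA /=; apply: eq_bigr => -[f z] _.
by rewrite law_sketch_obs mulrA.
Qed.

End Draw.

(** * Choice of the parameters *)

(** The strict inequality [1 + x < exp x] at [x = -1/8], raised to the eighth power, gives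
    [1/e > (7/8)^8 > 1/3]. *)
Lemma expR1_lt3 (R : realType) : expR 1 < 3 :> R.
Proof.
have h : (1 : R) - 8^-1 < expR (- 8^-1)
  by apply: expR_gt1Dx; rewrite oppr_eq0 invr_eq0 pnatr_eq0.
have : ((1 : R) - 8^-1) ^+ 8 < expR (- 8^-1) ^+ 8.
  by rewrite ltr_pXn2r // nnegrE ?expR_ge0 //; lra.
rewrite -expRM_natl (_ : 8%:R * - 8^-1 = -1) ?expRN; last by field.
move=> lt; rewrite -[ltLHS]invrK -[ltRHS]invrK
  ltf_pV2 ?posrE ?invr_gt0 ?expR_gt0 //.
by apply: le_lt_trans lt; lra.
Qed.

Lemma lnln3_gt0 (R : realType) : 0 < ln (ln 3) :> R.
Proof.
rewrite ln_gt0 // -[ltLHS]expRK ltr_ln ?posrE ?expR_gt0 //; exact: expR1_lt3.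
Qed.

Lemma expRN1_exp_le (R : realType) (y : R) (n : nat) : 0 < y -> ln y <= n%:R ->
  expR (-1) ^+ n <= y^-1.
Proof.
move=> y_gt0 ny; rewrite -expRM_natl mulrN1 expRN lef_pV2 ?posrE ?expR_gt0 //.
by rewrite -[leLHS]lnK ?posrE // ler_expR.
Qed.

Lemma ln_ge1_ge1 (R : realType) (y : R) : 1 <= ln_ge1 y.
Proof. by rewrite /ln_ge1 le_max lexx. Qed.

Lemma ln_ge1_ge_ln (R : realType) (y : R) : ln y <= ln_ge1 y.
Proof. by rewrite /ln_ge1 le_max lexx orbT. Qed.

Lemma norm1_ge0 (R : realType) (N : nat) (v : 'I_N -> R) : 0 <= norm1 v.
Proof. exact: sumr_ge0. Qed.

Lemma le_norm1 (R : realType) (N : nat) (v : 'I_N -> R) (i : 'I_N) :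
  `|v i| <= norm1 v.
Proof. by rewrite /norm1 (bigD1 i) //= lerDl sumr_ge0. Qed.

(** Each entry is the square of its root, and one of the two factors is at most the norm of the
    vector of roots. *)
Lemma norm1_le_sqrt_vec (R : realType) (N : nat) (v : 'I_N -> R) :
  (forall i, 0 <= v i) -> norm1 v <= norm1 (sqrt_vec v) ^+ 2.
Proof.
move=> v_ge0; rewrite expr2 {2}/norm1 mulr_sumr; apply: ler_sum => i _.
rewrite (ger0_norm (v_ge0 i)) -[leLHS]sqr_sqrtr // expr2.
by rewrite [`|sqrt_vec v i|]ger0_norm ?sqrtr_ge0 // ler_wpM2r ?sqrtr_ge0 //
  (le_trans _ (le_norm1 _ i)) // ler_norm.
Qed.

Section Bound.
Variables (R : realType) (N : nat) (s : 'I_N -> R) (eps delta : R).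
Hypotheses (N_gt0 : (0 < N)%N) (eps_gt0 : 0 < eps) (delta01 : 0 < delta < 1).

Lemma race_cms_bound_ge0 : 0 <= race_cms_bound (@ln_ge1 R) s eps delta.
Proof.
rewrite /race_cms_bound; set a := ln_ge1 _; set b := ln_ge1 (N%:R / delta).
have ? : 0 <= a by apply: le_trans (ln_ge1_ge1 _).
have ? : 0 <= b by apply: le_trans (ln_ge1_ge1 _).
by rewrite !mulr_ge0 ?norm1_ge0 ?sqr_ge0 // invr_ge0 exprn_ge0 // ltW.
Qed.

(** Under these conditions [ln (N / delta) >= ln 3 > 1], so the outer truncation is inactive. The
    inner argument [y] is at least [ln 3], so [ln y >= ln (ln 3) > 0], and a constant factor absorbs
    the inner truncation. *)
Lemma race_cms_bound_ln : (2 < N)%N -> eps <= norm1 s ->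
  race_cms_bound (@ln_ge1 R) s eps delta <=
  (1 + (ln (ln 3))^-1) * race_cms_bound (@ln R) s eps delta.
Proof.
case/andP: delta01 => delta_gt0 delta_lt1 N_gt2 eps_le.
have c0 := lnln3_gt0 R.
have Nd_ge3 : 3 <= N%:R / delta.
  rewrite ler_pdivlMr //; apply: (@le_trans _ _ 3).
    by rewrite ler_piMr // ltW.
  by rewrite ler_nat.
have L_ge : ln 3 <= ln (N%:R / delta).
  by rewrite ler_ln ?posrE // (lt_le_trans _ Nd_ge3).
have ln3_gt1 : 1 < ln 3 :> R.
  by rewrite -[ltLHS]expRK ltr_ln ?posrE ?expR_gt0 // expR1_lt3.
have LE : ln_ge1 (N%:R / delta) = ln (N%:R / delta).
  by apply/max_idPr; apply: le_trans L_ge; exact: ltW.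
rewrite /race_cms_bound LE; set L := ln (N%:R / delta) in L_ge *.
set y := norm1 s / (eps * delta) * L.
have y_ge : ln 3 <= y.
  apply: (le_trans L_ge); rewrite ler_peMl //.
    by apply: le_trans (ltW (lt_trans _ ln3_gt1)) (L_ge).
  rewrite ler_pdivlMr ?mulr_gt0 // mul1r; apply: le_trans eps_le.
  by rewrite ler_piMr // ltW.
have lny_ge : ln (ln 3) <= ln y.
  by rewrite ler_ln ?posrE //; [|apply: lt_le_trans y_ge]; apply: lt_trans ln3_gt1.
have ge1y : ln_ge1 y <= (1 + (ln (ln 3))^-1) * ln y.
  have lny_gt0 : 0 < ln y by apply: lt_le_trans lny_ge.
  have : 1 <= (ln (ln 3))^-1 * ln y by rewrite mulrC ler_pdivlMr // mul1r.
  have : 0 <= (ln (ln 3))^-1 * ln y by rewrite mulr_ge0 ?invr_ge0 // ltW.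
  by rewrite /ln_ge1 ge_max mulrDl mul1r; move=> *; apply/andP; split; lra.
set A := _ / _; rewrite mulrA ler_wpM2r //.
  by apply: le_trans L_ge; apply: ltW; apply: lt_trans ln3_gt1.
rewrite mulrCA ler_wpM2l // mulr_ge0 ?invr_ge0 ?exprn_ge0 ?(ltW eps_gt0) //.
by rewrite mulr_ge0 ?norm1_ge0 ?sqr_ge0.
Qed.

(** These constants bound [d.+1], [w.+1], [m] and [g], rounding included, relative to
    [log (N / delta)], [S / eps], [Q / eps^2] and the inner logarithm, where [S] is the norm of [s]
    and [Q] the squared norm of its root vector. *)
Definition row_overhead : R := 3.
Definition column_overhead : R := 4 * expR 1 + 2.
Definition mean_overhead : R := 64 * expR 1 ^+ 2 + 4.
Definition median_overhead : R := ln (2 * row_overhead * column_overhead) + 2.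
Definition overhead : R :=
  row_overhead * column_overhead * median_overhead * mean_overhead.

Lemma overhead_gt0 : 0 < overhead.
Proof.
have e_gt0 := @expR_gt0 R 1.
rewrite /overhead !mulr_gt0 //.
- by rewrite /column_overhead; lra.
- rewrite /median_overhead ltr_wpDl //; apply: ln_ge0.
  by rewrite /row_overhead /column_overhead; lra.
- by rewrite /mean_overhead addr_gt0 // mulr_gt0 // exprn_gt0.
Qed.

(** The parameters serve the accuracy bound with [t = eps / 4] and [rho = 1/e]. Each of the two
    failure terms is brought down to [delta / 2]. *)
Lemma race_cms_parameters :
  (forall i, 0 <= s i <= 1) -> (exists i, eps / 2 < s i) ->
  exists d w g m : nat,
  [/\ (race_cms_size d w g m)%:R <=
        overhead * race_cms_bound (@ln_ge1 R) s eps delta,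
      (0 < m)%N,
      norm1 s / w.+1%:R / (eps / 4) <= expR (-1),
      norm1 (sqrt_vec s) ^+ 2 / (m%:R * (eps / 4) ^+ 2) <= (expR (-1) / 2) ^+ 2 &
      N%:R * expR (-1) ^+ d.+1 + (d.+1 * w.+1)%:R * expR (-1) ^+ g <= delta].
Proof.
case/andP: delta01 => delta_gt0 delta_lt1 s01 [i0 big].
set S := norm1 s; set Q := norm1 (sqrt_vec s) ^+ 2; pose e : R := expR 1.
have e_gt0 : 0 < e by exact: expR_gt0.
have N0 : 0 < N%:R :> R by rewrite ltr0n.
have S_gt : eps / 2 < S.
  by apply: (lt_le_trans big); apply: le_trans (le_norm1 _ i0); exact: ler_norm.
have S_gt0 : 0 < S by apply: lt_trans S_gt; rewrite divr_gt0.
have Q_ge : S <= Q by apply: norm1_le_sqrt_vec => i; case/andP: (s01 i).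
have eps_lt2 : eps < 2 by have /andP[_] := s01 i0; lra.
pose L1 := ln_ge1 (N%:R / delta); have L1_ge1 : 1 <= L1 := ln_ge1_ge1 _.
pose y := S / (eps * delta) * L1.
have y_gt0 : 0 < y by rewrite !mulr_gt0 ?invr_gt0 ?mulr_gt0 //; lra.
pose L2 := ln_ge1 y; have L2_ge1 : 1 <= L2 := ln_ge1_ge1 _.
have truncn_leD1 (z : R) : 0 <= z -> (Num.truncn z).+1%:R <= z + 1.
  by move=> z0; rewrite -natr1 lerD2r truncn_le.
have Nd_gt1 : 1 <= N%:R / delta.
  by rewrite ler_pdivlMr // mul1r (le_trans (ltW delta_lt1)) // ler1n.
(* With [d.+1 >= ln zd] the Count-Min failure is at most [N / zd = delta / 2]. *)
pose zd := 2 * (N%:R / delta); pose d := Num.truncn (ln zd).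
have zd_ge1 : 1 <= zd by rewrite /zd; lra.
have ln2 : ln 2 <= 1 :> R.
  by have := @le_ln1Dx R 1; rewrite -[1 + 1]/2%:R; apply; lra.
have D_le : d.+1%:R <= row_overhead * L1.
  apply: le_trans (truncn_leD1 _ (ln_ge0 zd_ge1)) _.
  rewrite lnM ?posrE //; last by lra.
  have := ln_ge1_ge_ln (N%:R / delta); rewrite -/L1 /row_overhead; lra.
(* The least real width for which Markov's bound at [eps / 4] is [1/e]. *)
pose zw := 4 * e * (S / eps); pose w := Num.truncn zw.
have zw_ge0 : 0 <= zw by rewrite /zw !mulr_ge0 // ?invr_ge0 ltW.
have W_le : w.+1%:R <= column_overhead * (S / eps).
  apply: le_trans (truncn_leD1 _ zw_ge0) _.
  rewrite /zw /column_overhead [leRHS]mulrDl lerD2l.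
  (* Rounding costs 1, at most [2 * S / eps]. *)
  by rewrite mulrA ler_pdivlMr //; lra.
(* Solves [Q / (m * (eps / 4)^2) = (1 / (2 * e))^2] for [m]. *)
pose zm := 64 * e ^+ 2 * (Q / eps ^+ 2); pose m := (Num.truncn zm).+1.
have eps2_gt0 : 0 < eps ^+ 2 by rewrite exprn_gt0.
have Q_ge0 : 0 <= Q by apply: sqr_ge0.
have zm_ge0 : 0 <= zm.
  apply: mulr_ge0; first by apply: mulr_ge0 => //; exact: sqr_ge0.
  by apply: divr_ge0 => //; exact: sqr_ge0.
have M_le : m%:R <= mean_overhead * (Q / eps ^+ 2).
  apply: le_trans (truncn_leD1 _ zm_ge0) _.
  rewrite /zm /mean_overhead [leRHS]mulrDl lerD2l.
  rewrite mulrA ler_pdivlMr // mul1r.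
  (* Rounding costs 1, at most [4 * Q / eps^2], because [eps^2 <= 2 * eps < 4 * S <= 4 * Q]. *)
  have : eps ^+ 2 <= 2 * eps by rewrite expr2 ler_pM2r // ltW.
  lra.
pose zg := 2 * (d.+1 * w.+1)%:R / delta; pose g := (Num.truncn (ln zg)).+1.
have zg_ge1 : 1 <= zg.
  rewrite /zg ler_pdivlMr // mul1r; apply: le_trans (ltW delta_lt1) _.
  have : 1 <= (d.+1 * w.+1)%:R :> R by rewrite ler1n.
  lra.
have G_le : g%:R <= median_overhead * L2.
  apply: le_trans (truncn_leD1 _ (ln_ge0 zg_ge1)) _.
  pose c : R := 2 * row_overhead * column_overhead.
  have c_ge1 : 1 <= c by rewrite /c /row_overhead /column_overhead -/e; lra.
  (* The number of cells is at most a constant times [L1 * S / eps], which is where the argument of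
     the inner logarithm comes from. *)
  have zg_le : zg <= c * y.
    rewrite /zg natrM ler_pdivrMr //.
    have -> : c * y * delta =
        2 * ((row_overhead * L1) * (column_overhead * (S / eps))).
      by rewrite /c /y; field; rewrite !gt_eqF.
    by rewrite ler_pM2l // ler_pM.
  have c_gt0 : 0 < c by apply: lt_le_trans c_ge1.
  have zg_gt0 : 0 < zg by apply: lt_le_trans zg_ge1.
  have cy_gt0 : 0 < c * y by exact: mulr_gt0.
  have : ln zg <= ln c + ln y by rewrite -lnM ?posrE // ler_ln ?posrE.
  have := ln_ge1_ge_ln y; rewrite -/L2 /median_overhead -/c => lny lnzg.
  have : 0 <= ln c by apply: ln_ge0.
  move=> lnc; have : ln c <= ln c * L2 by rewrite ler_peMr.
  rewrite mulrDl; lra.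
exists d, w, g, m; split => //.
- rewrite /race_cms_size /race_cms_bound -/S -/Q -/L1 -/y -/L2.
  rewrite [leRHS](_ : _ = (row_overhead * L1) * (column_overhead * (S / eps)) *
    ((median_overhead * L2) * (mean_overhead * (Q / eps ^+ 2)))).
    by rewrite !natrM; do !apply: ler_pM; rewrite ?mulr_ge0.
  by rewrite /overhead; field; rewrite gt_eqF.
- rewrite expRN -/e -mulrA -invfM ler_pdivrMr; last by rewrite !mulr_gt0 // divr_gt0.
  rewrite ler_pdivlMl //.
  have : zw <= w.+1%:R by apply: ltW; exact: truncnS_gt.
  rewrite /zw mulrA ler_pdivrMr //; lra.
- rewrite expRN -/e ler_pdivrMr; last by rewrite mulr_gt0 // exprn_gt0 // divr_gt0.
  have : zm <= m%:R by apply: ltW; exact: truncnS_gt.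
  rewrite /zm mulrA ler_pdivrMr // => h.
  rewrite [leRHS](_ : _ = (m%:R * eps ^+ 2) / (64 * e ^+ 2)).
    by rewrite ler_pdivlMr ?mulr_gt0 ?exprn_gt0 // mulrC.
  by field; rewrite gt_eqF.
- have hd : expR (-1) ^+ d.+1 <= zd^-1.
    by apply: expRN1_exp_le; [lra|apply: ltW; exact: truncnS_gt].
  have hg : expR (-1) ^+ g <= zg^-1.
    by apply: expRN1_exp_le; [lra|apply: ltW; exact: truncnS_gt].
  apply: (@le_trans _ _ (N%:R * zd^-1 + (d.+1 * w.+1)%:R * zg^-1)).
    by rewrite lerD // ler_wpM2l.
  rewrite /zd /zg le_eqVlt; apply/orP; left; apply/eqP; field.
  by rewrite !gt_eqF // ltr0n.
Qed.

End Bound.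

(** * The empty sketch and the conclusion *)

(** Without groups the list of means is empty, and both middle entries are the default 0 of
    [nth]. *)
Lemma race_cms_empty (R : realType) (X : Type) (r K N : nat)
    (h : 'I_1 -> 'I_N -> 'I_1) (l : lsh_index 0 0 0 0 K -> X -> 'I_r.+1)
    (x : 'I_N -> X) (q : X) (i : 'I_N) : race_cms R h l x q i = 0.
Proof.
have cell0 a b : race_cms_cell R h l x q a b = 0.
  rewrite /race_cms_cell /median_of_means.
  have -> : enum 'I_0 = [::] by apply: size0nil; rewrite size_enum_ord.
  by rewrite /median /= addr0 mul0r.
rewrite /race_cms; under eq_bigr do rewrite cell0.
by rewrite cell0 big_ord_recl big_ord0 minxx.
Qed.

(** The constant is uniform in all data, and the parameters are fixed before the random functions.
    With the plain logarithm the bound can be negative for small [N] or large [eps], hence the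
    conditions on the second size estimate. *)
Theorem theorem6 (R : realType) :
  exists2 C : R, 0 < C &
  forall (X : Type) (r : nat) (mu : probability (funspace X r) R)
    (N : nat) (x : 'I_N -> X) (q : X) (K : nat) (eps delta : R),
  (0 < N)%N -> (0 < K)%N -> 0 < eps -> 0 < delta < 1 ->
  let s := similarity mu K x q in
  exists d w g m : nat,
  [/\ (race_cms_size d w g m)%:R <= C * race_cms_bound (@ln_ge1 R) s eps delta,
      (2 < N)%N -> eps <= norm1 s ->
        (race_cms_size d w g m)%:R <= C * race_cms_bound (@ln R) s eps delta
    & forall (disp : measure_display) (T : measurableType disp)
        (P : probability T R)
        (h : 'I_d.+1 -> {mfun T >-> funspace 'I_N w})
        (l : lsh_index d w g m K -> {mfun T >-> funspace X r}),
      race_cms_draw P mu h l ->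
      ((1 - delta)%:E <= P [set o | forall i : 'I_N,
         (s i - eps / 2
         <= race_cms R (fun a => h a o) (fun c => l c o) x q i
         <= s i + eps / 2)%R])%E].
Proof.
have c0 := lnln3_gt0 R; have oh := overhead_gt0 R.
have c_ge0 : 0 <= (ln (ln 3))^-1 :> R by rewrite invr_ge0 ltW.
exists (overhead R * (1 + (ln (ln 3))^-1)).
  by rewrite mulr_gt0 //; lra.
move=> X r mu N x q K eps delta N_gt0 K_gt0 eps_gt0 delta01 s.
have s01 i : 0 <= s i <= 1.
  rewrite /s similarityE collision_pow_ge0 ?collision_pow_le1 //;
    exact: lsh_law_distr.
have B_ge0 : 0 <= race_cms_bound (@ln_ge1 R) s eps delta.
  exact: race_cms_bound_ge0.
set C := overhead R * _.
have sizes (n : nat) :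
    n%:R <= overhead R * race_cms_bound (@ln_ge1 R) s eps delta ->
    n%:R <= C * race_cms_bound (@ln_ge1 R) s eps delta /\
    ((2 < N)%N -> eps <= norm1 s ->
     n%:R <= C * race_cms_bound (@ln R) s eps delta).
  move=> n_le; split=> [|N_gt2 eps_le]; apply: le_trans n_le _;
    rewrite /C -mulrA ler_pM2l //.
    by rewrite ler_peMl //; lra.
  exact: race_cms_bound_ln.
have [[i0 big]|small] := pselect (exists i, eps / 2 < s i); last first.
  (* One cell remains, but it uses no ACE estimates, so the size is 0. *)
  exists 0%N, 0%N, 0%N, 0%N.
  have [|b1 b2] := sizes 0%N; first by rewrite mulr_ge0 // ltW.
  split=> // disp T P h l _.
  rewrite [X in P X](_ : _ = setT) ?probability_setT.
    by rewrite lee_fin; case/andP: delta01; lra.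
  apply/seteqP; split=> // o _ i /=; rewrite race_cms_empty.
  have : s i <= eps / 2
    by rewrite leNgt; apply/negP => ?; apply: small; exists i.
  by have /andP[? _] := s01 i; move=> ?; apply/andP; split; lra.
have [d [w [g [m [size_le m_gt0 cms ace fail]]]]] :=
  race_cms_parameters N_gt0 eps_gt0 delta01 s01 (ex_intro _ i0 big).
exists d, w, g, m; have [b1 b2] := sizes _ size_le; split=> // disp T P h l draw.
have eps4_gt0 : 0 < eps / 4 by lra.
have rho01 : 0 <= expR (-1 : R) <= 1.
  by rewrite expR_ge0 expR_le1 oppr_le0 ler01.
have := race_cms_accurate draw m_gt0 eps4_gt0 rho01 cms ace.
rewrite (_ : eps / 4 + eps / 4 = eps / 2); last by lra.
by apply: le_trans; rewrite lee_fin lerD2l lerN2.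
Qed.
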